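(* Let $(\Omega,\mathcal F,\mathbf P)$, $A$, $X$, $\theta$, $\Theta=\mathbb R_{\ge 0}^n$, $G=\mathbb R_{>0}^d$, the action of $G$ on $\mathbb Z_{\ge 0}^d\times\Theta$ and the $\sigma$-algebra $\mathcal O$ be as described in the context. Then $\sigma(A\theta)$ is nuisance for $(\sigma(X),\mathcal O)$; that is, for every $Y\in\mathcal L^1(\sigma(X))$ some version of $\mathbf E(Y\mid\sigma(\mathcal O,\sigma(A\theta)))$ is $\mathcal O$-measurable.
   Context: Setting. $(\Omega,\mathcal F,\mathbf P)$ is a probability space, $A=(a_{ij})$ is a $d\times n$ integer matrix, $\Theta:=\mathbb R_{\ge 0}^n$ with Borel $\sigma$-algebra $\mathcal B(\Theta)$. The parameter is treated as a random variable: $\theta:\Omega\to\Theta$ is measurable, and $X=(X_1,\dots,X_n)^\top:\Omega\to\mathbb Z_{\ge 0}^n$ is a random vector such that, conditionally on $\theta=c$, the $X_k$ are mutually independent with $X_k\sim\mathrm{Pois}(c_k)$ ($\mathrm{Pois}(0)$ is the point mass at $0$). It is assumed that $AX$ takes values in $\mathbb Z_{\ge 0}^d$. $A\theta$ is the $\mathbb R^d$-valued random vector $\omega\mapsto A\,\theta(\omega)$. Group action. $G:=\mathbb R_{>0}^d$ acts on $\Theta$ by $g\cdot c=\bigl(c_j\prod_{i=1}^d g_i^{a_{ij}}\bigr)_{j=1,\dots,n}$ and on $\mathbb Z_{\ge 0}^d\times\Theta$ by $g\cdot(b,c)=(b,g\cdot c)$; $G\cdot B:=\{g\cdot x\mid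 g\in G,\ x\in B\}$. The $\sigma$-algebra $\mathcal O$ is $$\mathcal O:=\bigl\{\{(AX,\theta)\in B\}\ \big|\ B\in\mathcal B(\mathbb Z_{\ge 0}^d)\times\mathcal B(\Theta),\ G\cdot B=B\bigr\},$$ where $\mathcal B(\mathbb Z_{\ge 0}^d)\times\mathcal B(\Theta)$ is the product $\sigma$-algebra. Definitions. $\mathcal L^1(\mathcal H)$ is the space of integrable $\mathcal H$-measurable real random variables. A sub $\sigma$-algebra $\mathcal I$ is of interest with respect to $(\mathcal D,\mathcal G)$ if for all $Y\in\mathcal L^1(\mathcal D)$ a version of $\mathbf E(Y\mid\mathcal G)$ is $\mathcal I$-measurable. A sub $\sigma$-algebra $\mathcal N$ is nuisance for $(\mathcal D,\mathcal S)$ if $\mathcal S$ is of interest with respect to $(\mathcal D,\sigma(\mathcal S,\mathcal N))$. *)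

(* Defs.v *)
(* MathComp-Analysis *)
From HB Require Import structures.
From mathcomp Require Import all_boot all_order all_algebra.
From mathcomp Require Import all_classical all_reals all_analysis.

Set Implicit Arguments.
Unset Strict Implicit.
Unset Printing Implicit Defensive.
Import Order.TTheory GRing.Theory Num.Theory.
Import numFieldNormedType.Exports.

Local Open Scope classical_set_scope.
Local Open Scope ring_scope.

Section sub_sigma_algebras.
Context (dO : measure_display) (Omega : measurableType dO) (R : realType).
Variable P : probability Omega R.
Implicit Types (D G I N S H : set (set Omega)) (Y Z : Omega -> R).

Definition is_sub_sigma_algebra H : Prop :=
  sigma_algebra setT H /\ H `<=` measurable.

Definition sub_measurable H Y : Prop :=
  forall U : set R, measurable U -> H (Y @^-1` U).

Definition L1 H : set (Omega -> R) :=
  [set Y | sub_measurable H Y /\ P.-integrable setT (EFin \o Y)].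

(* Z is a version of E(Y | G), for Y integrable. *)
Definition cond_expectation G Y Z : Prop :=
  L1 G Z /\
  forall E, G E -> (\int[P]_(w in E) (Z w)%:E = \int[P]_(w in E) (Y w)%:E)%E.

(* The sigma-algebra generated by two sigma-algebras. *)
Definition sigma_join S N : set (set Omega) := <<s S `|` N >>.

Definition of_interest D G I : Prop :=
  is_sub_sigma_algebra I /\
  forall Y, L1 D Y ->
    exists2 Z, cond_expectation G Y Z & sub_measurable I Z.

Definition nuisance D S N : Prop :=
  is_sub_sigma_algebra N /\ of_interest D (sigma_join S N) S.

End sub_sigma_algebras.

Definition mutually_independent (d1 d2 : measure_display)
    (T1 : measurableType d1) (T2 : measurableType d2) (R : realType)
    (mu : set T1 -> \bar R) (I : finType) (f : I -> T1 -> T2) : Prop :=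
  forall (J : {set I}) (E : I -> set T2), (forall i, measurable (E i)) ->
    mu (\bigcap_(i in [set` J]) f i @^-1` E i) =
    (\prod_(i in J) mu (f i @^-1` E i))%E.

(* kappa is a regular conditional distribution of X given theta. *)
Definition regular_cond_distribution (d0 d1 d2 : measure_display)
    (Omega : measurableType d0) (T1 : measurableType d1)
    (T2 : measurableType d2) (R : realType) (P : probability Omega R)
    (X : {RV P >-> T2}) (theta : {RV P >-> T1})
    (kappa : R.-pker T1 ~> T2) : Prop :=
  forall (E : set T2) (B : set T1), measurable E -> measurable B ->
    P (X @^-1` E `&` theta @^-1` B) =
    (\int[distribution P theta]_(c in B) kappa c E)%E.

(* Theta, as a subset of R^n.  The measurable structure of [n.-tuple R] is
   the product of the Borel sigma-algebras, i.e. the Borel sigma-algebra of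
   R^n; that of [n.-tuple nat] is discrete. *)
Definition Theta (R : realType) (n : nat) : set (n.-tuple R) :=
  [set c | forall j, 0 <= tnth c j].

(* The second argument of [poisson_prob] is a dummy, and
   [poisson_prob 0 _] is the Dirac mass at 0. *)
Definition cond_indep_poisson (dO : measure_display)
    (Omega : measurableType dO) (R : realType) (P : probability Omega R)
    (n : nat) (X : {RV P >-> n.-tuple nat}) (theta : {RV P >-> n.-tuple R})
    : Prop :=
  exists kappa : R.-pker (n.-tuple R) ~> (n.-tuple nat),
    regular_cond_distribution X theta kappa /\
    forall c, Theta c ->
      mutually_independent (kappa c) (fun k : 'I_n => (@tnth n nat)^~ k) /\
      forall (k : 'I_n) (U : set nat),
        kappa c ((@tnth n nat)^~ k @^-1` U) = poisson_prob (tnth c k) 0%N U.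

Section matrix_action.
Context (R : realType) (d n : nat).
Variable A : 'M[int]_(d, n).

Definition mul_nat (x : n.-tuple nat) (i : 'I_d) : int :=
  \sum_(j < n) A i j * (tnth x j)%:Z.

(* A x as an element of N^d; meaningful when all [mul_nat x i] are
   nonnegative. *)
Definition AX (x : n.-tuple nat) : d.-tuple nat :=
  [tuple `|mul_nat x i|%N | i < d].

Definition Atheta (c : n.-tuple R) : d.-tuple R :=
  [tuple \sum_(j < n) (A i j)%:~R * tnth c j | i < d].

Definition posG : set (d.-tuple R) := [set g | forall i, 0 < tnth g i].

Definition act (g : d.-tuple R) (c : n.-tuple R) : n.-tuple R :=
  [tuple tnth c j * \prod_(i < d) tnth g i ^ A i j | j < n].

Definition act_pair (g : d.-tuple R) (x : d.-tuple nat * n.-tuple R)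
    : d.-tuple nat * n.-tuple R := (x.1, act g x.2).

Definition orbit_set (B : set (d.-tuple nat * n.-tuple R)) :
    set (d.-tuple nat * n.-tuple R) :=
  [set act_pair g x | g in posG & x in B].

(* As Theta is Borel in R^n, the measurable subsets of N^d x Theta are the
   measurable subsets of N^d x R^n contained in N^d x Theta. *)
Definition calO (Omega : Type) (X : Omega -> n.-tuple nat)
    (theta : Omega -> n.-tuple R) : set (set Omega) :=
  [set (fun w => (AX (X w), theta w)) @^-1` B | B in
    [set B : set (d.-tuple nat * n.-tuple R) |
      [/\ measurable B, B `<=` setT `*` @Theta R n & orbit_set B = B]]].

End matrix_action.

(* Main.v *)
(* The version of E(f(X) | AX, theta) given by
     h(b, c) = sum_(Ax = b) f(x) c^x/x! / sum_(Ax = b) c^x/x!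
   is G-invariant in c, because on the fibre Ax = b the action of g multiplies
   every c^x by the same factor g^b, while the factor e^(-|c|) of the Poisson
   weights cancels in the quotient.  Hence h(AX, theta) is O-measurable.  As
   O is contained in sigma(O, A theta), which is contained in
   sigma(AX, theta), the same variable is a version of
   E(f(X) | sigma(O, A theta)). *)
Require Import Defs.
From HB Require Import structures.
From mathcomp Require Import all_boot all_order all_algebra.
From mathcomp Require Import all_classical all_reals all_analysis.
From mathcomp Require Import measurable_realfun ring lra.
Set Implicit Arguments.
Unset Strict Implicit.
Unset Printing Implicit Defensive.
Import Order.TTheory GRing.Theory Num.Theory.
Import numFieldNormedType.Exports.
Local Open Scope classical_set_scope.
Local Open Scope ring_scope.

(** * Measurability on countable discrete spaces *)

Lemma measurable_tuple_nat n (U : set (n.-tuple nat)) : measurable U.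
Proof.
apply: countable_measurable => [t|]; last exact: countableP.
rewrite (_ : [set t] =
    \bigcap_(i in [set: 'I_n]) (@tnth n nat)^~ i @^-1` [set tnth t i]).
  apply: fin_bigcap_measurable => // i _.
  by rewrite -[X in measurable X]setTI; exact: measurable_tnth.
apply/seteqP; split=> [_ -> //|s ts]; apply: eq_from_tnth => i; exact: ts.
Qed.

Lemma measurable_prod_discretel d1 d2 (N : measurableType d1)
    (C : measurableType d2) (W : set (N * C)) :
  countable [set: N] -> (forall x : N, measurable [set x]) ->
  (forall x, measurable (xsection W x)) -> measurable W.
Proof.
move=> cN mN mW.
rewrite (_ : W = \bigcup_x ([set x] `*` xsection W x)).
  by apply: countable_bigcupT_measurable => // x; exact: measurableX.
apply/seteqP; split=> [[x c] Wxc|[x c] [y _ [/= -> ]]].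
  by exists x => //; split=> //=; rewrite /xsection/= inE.
by rewrite /xsection/= inE.
Qed.

(** * Disintegration of the joint law of [theta] and [X] *)

Section disintegration.
Local Open Scope ereal_scope.
Context d1 d2 (C : measurableType d1) (N : measurableType d2) (R : realType).
Context (dO : measure_display) (Omega : measurableType dO).
Variables (P : probability Omega R) (X : {RV P >-> N}) (theta : {RV P >-> C}).
Variable kappa : R.-pker C ~> N.
Hypothesis X_cond : regular_cond_distribution X theta kappa.

Let mu : probability C R := distribution P theta.


Let mpair (c : C) : measurable_fun [set: N] (pair c).
Proof. exact: measurable_pair1. Qed.

(** The kernel taking c to the product of the Dirac mass at c with [kappa c]. In [kcomp] the second
    kernel also sees the source of the first, and a measure on [C] is a kernel out of the one-point
    space; hence the dummy factor [unit]. *)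
Let kpair (z : unit * C) : {measure set (C * N) -> \bar R} :=
  measure_function_pushforward__canonical__measure_function_Measure
    (kappa z.2) (mpair z.2).

Let measurable_kpair U : measurable U ->
  measurable_fun [set: unit * C] (kpair ^~ U).
Proof.
move=> mU.
rewrite (_ : (kpair ^~ U) = (fun c => kappa c (xsection U c)) \o snd).
  apply: measurableT_comp => //.
  by apply: measurable_fun_xsection_finite_kernel; rewrite inE.
by apply/funext => z /=; rewrite xsectionE.
Qed.

HB.instance Definition _ := isKernel.Build _ _ _ _ _ kpair measurable_kpair.

Let kpair_prob z : kpair z [set: C * N] = 1.
Proof. by rewrite /kpair/= /pushforward preimage_setT prob_kernel. Qed.

HB.instance Definition _ :=
  Kernel_isProbability.Build _ _ _ _ _ kpair kpair_prob.

Let cst_mu (_ : unit) : pprobability C R := mu.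

Let measurable_cst_mu : measurable_fun [set: unit] cst_mu.
Proof. exact: measurable_cst. Qed.

Let joint := kcomp (kprobability measurable_cst_mu) kpair tt.

Let jointX A B : measurable A -> measurable B ->
  joint (A `*` B) = \int[mu]_(c in A) kappa c B.
Proof.
move=> mA mB; rewrite /joint /kcomp/= [RHS]integral_mkcond.
apply: eq_integral => c _; rewrite /pushforward patchE.
case: ifPn => [/set_mem|/negP] cA.
  by congr (kappa c _); apply/seteqP; split=> [x []|x].
rewrite [X in kappa c X](_ : _ = set0) ?measure0//.
by apply/seteqP; split=> x //= -[/mem_set].
Qed.

Let mpair_theta_X : measurable_fun [set: Omega] (fun w => (theta w, X w)).
Proof. exact: measurable_fun_pair. Qed.

Let law : {measure set (C * N) -> \bar R} :=
  measure_function_pushforward__canonical__measure_function_Measure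
    P mpair_theta_X.

(** The conditional distribution fixes both measures on rectangles only; these form a pi-system
    generating the product sigma-algebra, which determines finite measures. *)
Let law_joint U : measurable U -> law U = joint U.
Proof.
apply: (measure_unique [set A `*` B | A in measurable & B in measurable]
  (fun=> setT)).
- exact: measurable_prod_measurableType.
- move=> _ _ [A1 mA1 [B1 mB1 <-]] [A2 mA2 [B2 mB2 <-]].
  exists (A1 `&` A2); first exact: measurableI.
  by exists (B1 `&` B2); [exact: measurableI|rewrite setXI].
- by move=> _; exists setT => //; exists setT => //; rewrite setXTT.
- by rewrite bigcup_const.
- move=> _ [A mA [B mB <-]]; apply: eq_trans (esym (jointX mA mB)).
  rewrite -X_cond//.
  by rewrite /law/= /pushforward; congr (P _); apply/seteqP; split=> w [].
- by move=> _; rewrite /law/= /pushforward preimage_setT probability_setT ltry.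
Qed.

Lemma integral_disintegration (F : C * N -> \bar R) :
  measurable_fun setT F -> (forall z, 0 <= F z) ->
  \int[P]_w F (theta w, X w) =
  \int[distribution P theta]_c \int[kappa c]_x F (c, x).
Proof.
move=> mF F0.
transitivity (\int[law]_z F z).
  by rewrite ge0_integral_pushforward// preimage_setT.
transitivity (\int[joint]_z F z).
  by apply: eq_measure_integral => U mU _; exact: law_joint.
rewrite /joint integral_kcomp//=; apply: eq_integral => c _.
by rewrite ge0_integral_pushforward// preimage_setT.
Qed.

End disintegration.

(** * Means over the fibres of a map on a countable space *)

(* On a null fibre the inverse is [0^-1 = 0], so [cond_mean] is 0 there; the
   null fibres of a countable space have total mass 0. *)
Definition cond_mean d (N : measurableType d) (R : realType) (B : Type)
    (m : {measure set N -> \bar R}) (t : N -> B) (f : N -> \bar R) (b : B)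
    : \bar R :=
  ((\int[m]_(x in t @^-1` [set b]) f x) *
  ((fine (m (t @^-1` [set b])))^-1)%:E)%E.

Lemma cond_mean_ge0 d (N : measurableType d) (R : realType) (B : Type)
    (m : {measure set N -> \bar R}) (t : N -> B) (f : N -> \bar R) (b : B) :
  (forall x, 0 <= f x)%E -> (0 <= cond_mean m t f b)%E.
Proof.
move=> f0; apply: mule_ge0; first exact: integral_ge0.
by rewrite lee_fin invr_ge0 fine_ge0.
Qed.

Section averaging.
Local Open Scope ereal_scope.
Context d (N : measurableType d) (R : realType) (B : Type).
Variables (m : {finite_measure set N -> \bar R}) (t : N -> B).
Hypotheses (countN : countable [set: N]) (mN : forall U : set N, measurable U).

Let measurableN (g : N -> \bar R) : measurable_fun setT g.
Proof. by move=> _ U _; exact: mN. Qed.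

Let measurableNN (g : N * N -> \bar R) : measurable_fun setT g.
Proof. by move=> _ U _; exact: measurable_prod_discretel. Qed.

(** An injection into the naturals cuts the union of the null fibres into pieces with at most one
    point, each contained in the null fibre of its point. *)
Let ae_fiber_neq0 : {ae m, forall x, m (t @^-1` [set t x]) != 0}.
Proof.
have /countable_injP[i injf] := countN.
suff: m.-negligible (\bigcup_k [set x | m (t @^-1` [set t x]) = 0 /\ i x = k]).
  apply: negligibleS => x /=; move=> /negP; rewrite negbK => /eqP mx0.
  by exists (i x).
apply: negligible_bigcup => k; apply/negligibleP; first exact: mN.
set F := [set x | _ /\ _].
have [->|/set0P[x [mx0 ixk]]] := eqVneq F set0; first exact: measure0.
apply/eqP; rewrite -measure_le0 -mx0; apply: le_measure; rewrite ?inE.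
- exact: mN.
- exact: mN.
- move=> y [_ iyk] /=; congr t; apply: injf; rewrite ?inE//.
  by rewrite iyk.
Qed.

(* Fubini-Tonelli over the pairs (x, y) with [t x = t y] gives this for
   arbitrary [f >= 0], even if some fibre means are infinite. *)
Lemma integral_cond_mean (f : N -> \bar R) (phi : B -> \bar R) :
  (forall x, 0 <= f x) -> (forall b, 0 <= phi b) ->
  \int[m]_x (phi (t x) * cond_mean m t f (t x)) = \int[m]_x (phi (t x) * f x).
Proof.
move=> f0 phi0.
pose M b := m (t @^-1` [set b]).
pose g b := phi b * ((fine (M b))^-1)%:E.
have g0 b : 0 <= g b by rewrite mule_ge0// lee_fin invr_ge0 fine_ge0.
pose H (z : N * N) := g (t z.1) * ((\1_(t @^-1` [set t z.1]) z.2)%:E * f z.2).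
have H0 z : 0 <= H z by rewrite /H mule_ge0// mule_ge0// lee_fin.
transitivity (\int[m]_x \int[m]_y H (x, y)).
  apply: eq_integral => x _; rewrite /H/= ge0_integralZl//; last first.
    by move=> y _; rewrite mule_ge0// lee_fin.
  rewrite /g /cond_mean -[RHS]muleA; congr (_ * _); rewrite muleC.
  congr (_ * _); rewrite integral_mkcond; apply: eq_integral => y _.
  rewrite patchE indicE; case: ifPn => _; by rewrite ?mul1e ?mul0e.
rewrite fubini_tonelli//.
transitivity (\int[m]_y (M (t y) * (g (t y) * f y))).
  apply: eq_integral => y _.
  transitivity (\int[m]_x ((g (t y) * f y) * (\1_(t @^-1` [set t y]) x)%:E)).
    apply: eq_integral => x _; rewrite /H/= !indicE.
    have [xy|xy] := pselect (t x = t y).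
      by rewrite !mem_set//= xy mule1 mul1e.
    by rewrite !memNset//= ?mul0e ?mule0// => /esym.
  rewrite ge0_integralZl//; last by rewrite mule_ge0.
  by rewrite integral_indic// setIT muleC.
apply: ge0_ae_eq_integral => //.
- by move=> y _; apply: mule_ge0; [exact: measure_ge0|exact: mule_ge0].
- by move=> y _; rewrite mule_ge0.
(* Off the null fibres the mass [M (t y)] produced by the inner integral cancels its inverse in [g];
   on a null fibre their product would be 0, not 1. *)
apply: filterS ae_fiber_neq0 => y My _.
have Mfin : M (t y) \is a fin_num by exact: fin_num_measure.
rewrite muleA; congr (_ * _).
rewrite /g muleCA -{1}(fineK Mfin) -EFinM divff ?mule1//.
by rewrite fine_eq0.
Qed.

End averaging.

(** * Fibre means of proportional measures *)

Lemma eq_measure_countable d (N : measurableType d) (R : realType)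
    (m1 m2 : {measure set N -> \bar R}) (D : set N) :
  countable [set: N] -> (forall U : set N, measurable U) ->
  (forall x, D x -> m1 [set x] = m2 [set x]) ->
  forall U, U `<=` D -> m1 U = m2 U.
Proof.
move=> /countable_injP[i injf] mN m12 U UD.
have -> : U = \bigcup_k [set x | U x /\ i x = k].
  by apply/seteqP; split=> [x Ux|x [k _ []]//]; exists (i x).
have tU : trivIset setT (fun k => [set x | U x /\ i x = k]).
  by move=> k l _ _ [x [[_ <-] [_ <-]]].
rewrite !measure_bigcup//; apply: eq_eseriesr => k _.
have [->|/set0P[x [Ux ixk]]] := eqVneq [set x | U x /\ i x = k] set0.
  by rewrite !measure0.
rewrite (_ : [set x | _] = [set x]) ?m12//; first exact: UD.
apply/seteqP; split=> [y [_ iyk]|_ -> //]; apply: injf; rewrite ?inE//.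
by rewrite iyk.
Qed.

(** Equality up to [k] on the points of the fibre extends to all its subsets by countable
    additivity. Integral and mass then both carry the factor [k], which cancels; as the inverse is
    multiplicative also at 0, null fibres need no separate treatment. *)
Lemma cond_mean_proportional d (N : measurableType d) (R : realType)
    (B : Type) (m1 m2 : {finite_measure set N -> \bar R}) (t : N -> B) (b : B)
    (k : R) (f : N -> \bar R) :
  countable [set: N] -> (forall U : set N, measurable U) ->
  0 < k -> (forall x, 0 <= f x)%E ->
  (forall x, t x = b -> m1 [set x] = k%:E * m2 [set x])%E ->
  cond_mean m1 t f b = cond_mean m2 t f b.
Proof.
move=> cN mN k0 f0 m12.
pose K : {nonneg R} := NngNum (ltW k0).
have mE U : U `<=` t @^-1` [set b] -> m1 U = mscale K m2 U.
  by apply: eq_measure_countable => // x /m12.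
rewrite /cond_mean.
rewrite [X in fine X](_ : _ = k%:E * m2 (t @^-1` [set b]))%E; last exact: mE.
rewrite (@eq_measure_integral _ _ _ _ (mscale K m2)); last first.
  by move=> U _; exact: mE.
rewrite ge0_integral_mscale//.
have /fineK <- : m2 (t @^-1` [set b]) \is a fin_num by exact: fin_num_measure.
rewrite -EFinM/= invfM EFinM.
rewrite muleACA -EFinM mulfV ?mul1e//; exact: lt0r_neq0.
Qed.

Section finite_kernel_at.
Context d1 d2 (C : measurableType d1) (N : measurableType d2) (R : realType).
Variable kappa : R.-fker C ~> N.

(* An alias carrying the finite measure structure, which the library does not
   attach to [kappa c]. *)
Definition kernel_at (c : C) : set N -> \bar R := kappa c.

HB.instance Definition _ c := Measure.on (kernel_at c).

HB.instance Definition _ c :=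
  Measure_isFinite.Build _ _ _ (kernel_at c) (finite_kernel_measure kappa c).

End finite_kernel_at.

(** * Point masses of independent Poisson variables *)

Section poisson_point.
Context (R : realType).

Definition poisson_weight (r : R) (k : nat) : R :=
  r ^+ k * k`!%:R^-1 * expR (- r).

Lemma poisson_prob1 (r : R) l (k : nat) : 0 <= r ->
  poisson_prob r l [set k] = (poisson_weight r k)%:E.
Proof.
(* At r = 0 the closed formula still holds: [0 ^+ 0 = 1] and [0 ^+ k = 0] for positive k reproduce
   the Dirac mass at 0. *)
rewrite le_eqVlt /poisson_prob => /predU1P[<-|r0].
  rewrite ltxx /poisson_weight oppr0 expR0 mulr1 diracE.
  have [->|k0] := eqVneq k 0%N.
    by rewrite mem_set// expr0 fact0 invr1 mulr1.
  rewrite memNset/= ?expr0n ?(negbTE k0) ?mul0r// => /esym/eqP.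
  by rewrite (negbTE k0).
rewrite r0 esum_set1 ?/poisson_pmf ?r0//.
by rewrite lee_fin !mulr_ge0// exprn_ge0// ltW.
Qed.

Lemma indep_poisson1 n (m : {measure set (n.-tuple nat) -> \bar R})
    (c : n.-tuple R) (x : n.-tuple nat) :
  Theta c ->
  mutually_independent m (fun k : 'I_n => (@tnth n nat)^~ k) ->
  (forall (k : 'I_n) (U : set nat),
    m ((@tnth n nat)^~ k @^-1` U) = poisson_prob (tnth c k) 0%N U) ->
  m [set x] = (\prod_(j < n) poisson_weight (tnth c j) (tnth x j))%:E.
Proof.
move=> c0 ind marg.
rewrite (_ : [set x] = \bigcap_(i in [set` [set: 'I_n]%SET])
    (@tnth n nat)^~ i @^-1` [set tnth x i]); last first.
  apply/seteqP; split=> [_ -> //|y xy]; apply: eq_from_tnth => i.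
  by apply: xy => /=; rewrite inE.
rewrite ind// -prodEFin; apply: eq_big => [i|i _]; first by rewrite inE.
by rewrite marg poisson_prob1.
Qed.

End poisson_point.

(** * The group action and its effect on Poisson weights *)

Section action.
Context (R : realType) (d n : nat) (A : 'M[int]_(d, n)).
Implicit Types (g : d.-tuple R) (c : n.-tuple R).

Lemma tnth_act g c j :
  tnth (act A g c) j = tnth c j * \prod_(i < d) tnth g i ^ A i j.
Proof. by rewrite tnth_mktuple. Qed.

Lemma act_Theta g c : posG g -> Theta c -> Theta (act A g c).
Proof.
move=> g0 c0 j; rewrite tnth_act mulr_ge0//.
by apply: prodr_ge0 => i _; rewrite exprz_ge0// ltW.
Qed.

Definition ginv g : d.-tuple R := [tuple (tnth g i)^-1 | i < d].

Lemma posG_ginv g : posG g -> posG (ginv g).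
Proof. by move=> g0 i; rewrite tnth_mktuple invr_gt0. Qed.

Lemma actK g c : posG g -> act A (ginv g) (act A g c) = c.
Proof.
move=> g0; apply: eq_from_tnth => j; rewrite !tnth_act -mulrA -big_split/=.
rewrite big1 ?mulr1// => i _; rewrite tnth_mktuple -expfzMl mulfV ?exp1rz//.
exact: lt0r_neq0.
Qed.

Lemma act1 c : act A [tuple 1 | i < d] c = c.
Proof.
apply: eq_from_tnth => j; rewrite tnth_act big1 ?mulr1// => i _.
by rewrite tnth_mktuple exp1rz.
Qed.

Lemma exprz_sum (r : R) (f : 'I_n -> int) : r != 0 ->
  r ^ (\sum_j f j) = \prod_j r ^ f j.
Proof.
move=> r0; elim/big_rec2: _ => [|j x y _ <-]; first exact: expr0z.
by rewrite expfzDr.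
Qed.

(** The monomial factors gained from [g] regroup, by exchanging the products over i and j, into g to
    the power Ax, so they depend on x only through Ax. The change of the exponential factors does
    not depend on x at all. *)
Lemma poisson_weight_act g c (x : n.-tuple nat) : posG g ->
  \prod_(j < n) poisson_weight (tnth (act A g c) j) (tnth x j) =
  ((\prod_(i < d) tnth g i ^ mul_nat A x i) *
    \prod_(j < n) expR (tnth c j - tnth (act A g c) j)) *
  \prod_(j < n) poisson_weight (tnth c j) (tnth x j).
Proof.
move=> g0.
have -> : \prod_(i < d) tnth g i ^ mul_nat A x i =
    \prod_(j < n) (\prod_(i < d) tnth g i ^ A i j) ^+ tnth x j.
  under [RHS]eq_bigr do rewrite -prodrXl; rewrite exchange_big/=.
  apply: eq_bigr => i _; rewrite /mul_nat exprz_sum ?lt0r_neq0//.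
  by apply: eq_bigr => j _; rewrite exprnP exprz_exp.
rewrite -!big_split/=; apply: eq_bigr => j _.
rewrite /poisson_weight {1}tnth_act exprMn expRD.
set a := tnth (act A g c) j; set G := _ ^+ tnth x j; set C := _ ^+ tnth x j.
(* Inserting exp(c_j) exp(-c_j) = 1 turns both sides into products of the same factors. *)
have {1}-> : expR (- a) = expR (- a) * (expR (tnth c j) * expR (- tnth c j)).
  by rewrite expRxMexpNx_1 mulr1.
by set F := (_`!%:R)^-1; ring.
Qed.

End action.

(** * Invariance of the fibre means under the group *)

Section invariance.
Context (R : realType) (d n : nat) (A : 'M[int]_(d, n)).
Variable kappa : R.-pker (n.-tuple R) ~> (n.-tuple nat).
Hypothesis kappa_poisson : forall c, Theta c ->
  mutually_independent (kappa c) (fun k : 'I_n => (@tnth n nat)^~ k) /\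
  forall (k : 'I_n) (U : set nat),
    kappa c ((@tnth n nat)^~ k @^-1` U) = poisson_prob (tnth c k) 0%N U.

Lemma cond_mean_act (g : d.-tuple R) (c : n.-tuple R)
    (f : n.-tuple nat -> \bar R) b :
  posG g -> Theta c -> (forall x, 0 <= f x)%E ->
  cond_mean (kappa (act A g c)) (mul_nat A) f b =
  cond_mean (kappa c) (mul_nat A) f b.
Proof.
move=> g0 c0 f0.
(* The constant is the factor from [poisson_weight_act], with the exponent Ax replaced by its value
   [b] on the fibre. *)
apply: (@cond_mean_proportional _ _ _ _
  (kernel_at kappa (act A g c)) (kernel_at kappa c) _ _
  ((\prod_(i < d) tnth g i ^ b i) *
    \prod_(j < n) expR (tnth c j - tnth (act A g c) j))) => //.
- exact: countableP.
- exact: measurable_tuple_nat.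
- apply: mulr_gt0; apply: prodr_gt0 => i _; last exact: expR_gt0.
  by rewrite exprz_gt0.
move=> x <- /=.
have [ind marg] := kappa_poisson c0.
have [indg margg] := kappa_poisson (act_Theta A g0 c0).
rewrite /kernel_at.
have -> := indep_poisson1 x (act_Theta A g0 c0) indg margg.
have -> := indep_poisson1 x c0 ind marg.
by rewrite poisson_weight_act.
Qed.

End invariance.

(** * Measurability of the fibre means in the parameter *)

Lemma measurable_fun_discretel d1 d2 d3 (N : measurableType d1)
    (C : measurableType d2) (U : measurableType d3) (g : N * C -> U) :
  countable [set: N] -> (forall x : N, measurable [set x]) ->
  (forall x, measurable_fun setT (fun c => g (x, c))) -> measurable_fun setT g.
Proof.
move=> cN mN mg _ V mV; rewrite setTI; apply: measurable_prod_discretel => // x.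
by rewrite xsectionE -[X in measurable X]setTI; exact: mg.
Qed.

Lemma measurable_fun_discreter d1 d2 d3 (C : measurableType d1)
    (N : measurableType d2) (U : measurableType d3) (g : C * N -> U) :
  countable [set: N] -> (forall x : N, measurable [set x]) ->
  (forall x, measurable_fun setT (fun c => g (c, x))) -> measurable_fun setT g.
Proof.
move=> cN mN mg.
have -> : g = (fun z => g (z.2, z.1)) \o (fun z => (z.2, z.1)).
  by apply/funext => -[].
apply: measurableT_comp; first exact: measurable_fun_discretel.
exact: measurable_fun_pair.
Qed.

Lemma measurable_cond_mean d1 d2 (C : measurableType d1) (N : measurableType d2)
    (R : realType) (B : Type) (kappa : R.-pker C ~> N) (t : N -> B)
    (f : N -> \bar R) (b : B) :
  (forall U : set N, measurable U) -> (forall x, 0 <= f x)%E ->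
  measurable_fun setT (fun c => cond_mean (kappa c) t f b).
Proof.
move=> mN f0; apply: emeasurable_funM.
  under eq_fun do rewrite integral_mkcond.
  apply: measurable_fun_integral_kernel => //.
  - by move=> U mU; exact: measurable_kernel.
  - by move=> x; rewrite patchE; case: ifP.
(* On the nonnegative reals, 0 included, inversion is the power function with exponent -1, which is
   measurable. *)
apply/measurable_EFinP; under eq_fun do rewrite -powR_inv1 ?fine_ge0//.
apply: (measurableT_comp (f := (@powR R)^~ (-1))).
  exact: measurable_powR.
by apply: measurableT_comp => //; exact: measurable_kernel.
Qed.

Lemma measurable_Theta (R : realType) n : measurable (@Theta R n).
Proof.
rewrite (_ : @Theta R n =
    \bigcap_(j in [set: 'I_n]) (@tnth n R)^~ j @^-1` `[0, +oo[).
  apply: fin_bigcap_measurable => // j _.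
  by rewrite -[X in measurable X]setTI; exact: measurable_tnth.
apply/seteqP; split=> [c c0 j _|c c0 j]; first by rewrite /= in_itv/= c0.
by have := c0 j I; rewrite /= in_itv/= andbT.
Qed.

Lemma measurable_Atheta (R : realType) d n (A : 'M[int]_(d, n)) :
  measurable_fun setT (@Atheta R d n A).
Proof.
apply/measurable_fun_tnthP => i.
rewrite (_ : _ \o _ = fun c => \sum_(j < n) (A i j)%:~R * tnth c j).
  apply: measurable_sum => j; apply: measurable_funM => //.
  exact: measurable_tnth.
by apply/funext => c; rewrite /= tnth_mktuple.
Qed.

(** * The sigma-algebra O of invariant events *)

Section calO.
Context (R : realType) (d n : nat) (A : 'M[int]_(d, n)).

(** The unit of the group always puts [B] inside its orbit set, so invariance amounts to closure
    under the action. Conversely, acting by [g] after [h] is acting by their product, so an orbit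
    set is closed. *)
Lemma orbit_setP (B : set (d.-tuple nat * n.-tuple R)) :
  orbit_set A B = B <->
  forall g b c, posG g -> B (b, c) -> B (b, act A g c).
Proof.
split=> [<- g b c g0 [h h0 [[b' c'] Bbc [<- <-]]]|BA].
  exists [tuple tnth g i * tnth h i | i < d].
    by move=> i; rewrite tnth_mktuple mulr_gt0.
  exists (b', c') => //; congr (_, _); apply: eq_from_tnth => j.
  rewrite !tnth_act -mulrA -big_split/=; congr (_ * _); apply: eq_bigr => i _.
  by rewrite tnth_mktuple expfzMl mulrC.
apply/seteqP; split=> [_ [g g0 [[b c] Bbc <-]]|[b c] Bbc]; first exact: BA.
exists [tuple 1 | i < d]; first by move=> i; rewrite tnth_mktuple.
by exists (b, c) => //; rewrite /act_pair act1.
Qed.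

Context (dO : measure_display) (Omega : measurableType dO).
Context (X : Omega -> n.-tuple nat) (theta : Omega -> n.-tuple R).
Hypothesis theta_ge0 : forall w, Theta (theta w).

Lemma calO_sigma_algebra : sigma_algebra setT (calO A X theta).
Proof.
split.
- exists set0; last by rewrite preimage_set0.
  by split=> //; apply/orbit_setP.
- move=> _ [B [mB BT /orbit_setP BA] <-].
  (* The complement is taken inside the domain with parameters in [Theta]; its preimage is the full
     complement because [theta] has values there. Its invariance comes from acting with the inverse
     group element. *)
  exists ((setT `*` @Theta R n) `\` B); last first.
    by apply/seteqP; split=> w /= [// _ Bw]; split.
  split; first by apply: measurableD => //; apply: measurableX => //;
    exact: measurable_Theta.
    by move=> z [].
  apply/orbit_setP => g b c g0 [[_ /= c0] Bbc]; split.
    by split=> //=; exact: act_Theta.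
  by move=> /(BA (ginv g) _ _ (posG_ginv g0)); rewrite actK.
- move=> E HE.
  have /choice[B HB] : forall k, exists B : set (d.-tuple nat * n.-tuple R),
      [/\ measurable B, B `<=` setT `*` @Theta R n & orbit_set A B = B] /\
      (fun w => (AX A (X w), theta w)) @^-1` B = E k.
    by move=> k; have [B ? ?] := HE k; exists B.
  exists (\bigcup_k B k); last first.
    rewrite preimage_bigcup; apply: eq_bigcupr => k _; exact: (HB k).2.
  split.
  + by apply: bigcupT_measurable => k; have [[]] := HB k.
  + by move=> z [k _ Bz]; have [[_ + _] _] := HB k; exact.
  + apply/orbit_setP => g b c g0 [k _ Bbc]; exists k => //.
    by have [[_ _ /orbit_setP BA] _] := HB k; exact: BA.
Qed.

(** Since [h] is invariant only over [Theta], its level sets are first intersected with that domain,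
    which leaves their preimages unchanged. *)
Lemma sub_measurable_calO (h : d.-tuple nat * n.-tuple R -> R) :
  measurable_fun setT h ->
  (forall g b c, posG g -> Theta c -> h (b, act A g c) = h (b, c)) ->
  sub_measurable (calO A X theta) (fun w => h (AX A (X w), theta w)).
Proof.
move=> mh hA U mU; exists ((setT `*` @Theta R n) `&` h @^-1` U); last first.
  by apply/seteqP; split=> w /=; [case|].
split.
- apply: measurableI.
    by apply: measurableX => //; exact: measurable_Theta.
  by rewrite -[X in measurable X]setTI; exact: mh.
- by move=> z [].
- apply/orbit_setP => g b c g0 [[_ /= c0] hU]; split.
    by split=> //=; exact: act_Theta.
  by rewrite /= hA.
Qed.

End calO.

(** * The fibre mean as a conditional expectation given AX and [theta] *)

Section cond_mean_X.
Context (R : realType) (dO : measure_display) (Omega : measurableType dO).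
Context (P : probability Omega R) (d n : nat) (A : 'M[int]_(d, n)).
Context (X : {RV P >-> n.-tuple nat}) (theta : {RV P >-> n.-tuple R}).
Hypothesis AX_ge0 : forall w i, 0 <= mul_nat A (X w) i.
Variable kappa : R.-pker (n.-tuple R) ~> (n.-tuple nat).
Hypothesis X_cond : regular_cond_distribution X theta kappa.

Local Notation AXtheta w := (AX A (X w), theta w).

(** The fibres are those of the signed vector [mul_nat A]. Fibres of [AX A] could merge vectors Ax
    differing in sign, on which the scaling factor of the action is not constant. *)
Definition cond_mean_AX (f : n.-tuple nat -> R)
    (z : d.-tuple nat * n.-tuple R) : \bar R :=
  cond_mean (kappa z.2) (mul_nat A) (EFin \o f) (fun i => (tnth z.1 i)%:Z).

Lemma measurable_AXtheta : measurable_fun setT (fun w => AXtheta w).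
Proof.
apply: measurable_fun_pair => //.
apply: (measurableT_comp (f := AX A)) => // _ U _.
exact: measurable_tuple_nat.
Qed.

Lemma measurable_cond_mean_AX f : (forall x, 0 <= f x) ->
  measurable_fun setT (cond_mean_AX f).
Proof.
move=> f0; apply: measurable_fun_discretel => [|x|b].
- exact: countableP.
- exact: measurable_tuple_nat.
- rewrite /cond_mean_AX /=.
  have f0' x : (0 <= (EFin \o f) x)%E by rewrite lee_fin.
  exact: (measurable_cond_mean kappa (mul_nat A) (fun i => (tnth b i)%:Z)
    (@measurable_tuple_nat n) f0').
Qed.

Lemma cond_mean_AX_ge0 f z : (forall x, 0 <= f x) -> (0 <= cond_mean_AX f z)%E.
Proof.
by move=> f0; apply: cond_mean_ge0 => x; rewrite lee_fin.
Qed.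

(** Disintegration reduces the identity to a fixed parameter c. There the indicator of [B] depends
    on x only through Ax, so [integral_cond_mean] applies to [kappa c] with this indicator as test
    function. Nonnegativity of [f] replaces integrability. *)
Lemma integral_cond_mean_AX f (B : set (d.-tuple nat * n.-tuple R)) :
  measurable B -> (forall x, 0 <= f x) ->
  (\int[P]_(w in (fun w => AXtheta w) @^-1` B) cond_mean_AX f (AXtheta w) =
   \int[P]_(w in (fun w => AXtheta w) @^-1` B) (f (X w))%:E)%E.
Proof.
move=> mB f0; rewrite [LHS]integral_mkcond [RHS]integral_mkcond.
pose absb (b : 'I_d -> int) : d.-tuple nat := [tuple `|b i|%N | i < d].
pose phi c b : \bar R := (\1_B (absb b, c))%:E.
have phi0 c b : (0 <= phi c b)%E by rewrite lee_fin.
pose F (z : n.-tuple R * n.-tuple nat) : \bar R :=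
  (phi z.1 (mul_nat A z.2) *
   cond_mean (kappa z.1) (mul_nat A) (EFin \o f) (mul_nat A z.2))%E.
pose F' (z : n.-tuple R * n.-tuple nat) : \bar R :=
  (phi z.1 (mul_nat A z.2) * (f z.2)%:E)%E.
transitivity (\int[P]_w F (theta w, X w))%E.
  apply: eq_integral => w _.
  rewrite epatch_indic muleC /F/=; congr (_ * _)%E.
  (* Here the nonnegativity of Ax along [X] enters: it makes the absolute values in [AX]
     harmless. *)
  rewrite /cond_mean_AX/=; congr cond_mean; apply/funext => i.
  by rewrite tnth_mktuple gez0_abs.
transitivity (\int[P]_w F' (theta w, X w))%E; last first.
  by apply: eq_integral => w _; rewrite epatch_indic muleC.
have f0' x : (0 <= (EFin \o f) x)%E by rewrite lee_fin.
have mphi x : measurable_fun setT (fun c => phi c (mul_nat A x)).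
  apply/measurable_EFinP.
  apply: (measurableT_comp (f := \1_B : _ -> R)
    (g := pair (absb (mul_nat A x)))).
    exact: measurable_indic.
  exact: measurable_pair1.
have mF : measurable_fun setT F.
  apply: measurable_fun_discreter => [|x|x].
  - exact: countableP.
  - exact: measurable_tuple_nat.
  apply: emeasurable_funM; first exact: mphi.
  exact: (measurable_cond_mean kappa (mul_nat A) (mul_nat A x)
    (@measurable_tuple_nat n) f0').
have mF' : measurable_fun setT F'.
  apply: measurable_fun_discreter => [|x|x].
  - exact: countableP.
  - exact: measurable_tuple_nat.
  apply: emeasurable_funM; first exact: mphi.
  exact: (measurable_cst (f x)%:E).
have F0 z : (0 <= F z)%E.
  by apply: mule_ge0; [exact: phi0|exact: cond_mean_ge0].
have F'0 z : (0 <= F' z)%E by apply: mule_ge0; [exact: phi0|exact: f0'].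
rewrite (integral_disintegration X_cond mF F0).
rewrite (integral_disintegration X_cond mF' F'0).
apply: eq_integral => c _.
have cN : countable [set: n.-tuple nat] by exact: countableP.
exact: (@integral_cond_mean _ _ _ _ (kernel_at kappa c) (mul_nat A) cN
  (@measurable_tuple_nat n) (EFin \o f) (phi c) f0' (phi0 c)).
Qed.


Lemma integrable_cond_mean_AX f : (forall x, 0 <= f x) ->
  P.-integrable setT (EFin \o (f \o X)) ->
  P.-integrable setT (fun w => cond_mean_AX f (AXtheta w)).
Proof.
move=> f0 /integrableP[mf intf]; apply/integrableP; split.
  exact: measurableT_comp (measurable_cond_mean_AX f0) measurable_AXtheta.
apply: le_lt_trans intf.
under eq_integral do rewrite gee0_abs ?cond_mean_AX_ge0//.
have := integral_cond_mean_AX measurableT f0; rewrite preimage_setT => ->.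
by rewrite le_eqVlt; apply/orP; left; apply/eqP/eq_integral => w _ /=;
  rewrite ger0_norm.
Qed.

(** Versions must be real-valued, so infinite means are set to 0. If f(X) is integrable, this
    changes the variable only on a null event, and invariance survives since it holds pointwise
    before [fine]. *)
Definition fine_cond_mean_AX (f : n.-tuple nat -> R)
    (z : d.-tuple nat * n.-tuple R) : R :=
  fine (cond_mean_AX f z).

Lemma measurable_fine_cond_mean_AX f : (forall x, 0 <= f x) ->
  measurable_fun setT (fine_cond_mean_AX f).
Proof.
by move=> f0; apply: measurableT_comp => //; exact: measurable_cond_mean_AX.
Qed.

Lemma integrable_fine_cond_mean_AX f : (forall x, 0 <= f x) ->
  P.-integrable setT (EFin \o (f \o X)) ->
  P.-integrable setT (fun w => (fine_cond_mean_AX f (AXtheta w))%:E).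
Proof.
move=> f0 intf; apply: le_integrable (integrable_cond_mean_AX f0 intf) => //.
  apply/measurable_EFinP.
  exact: measurableT_comp (measurable_fine_cond_mean_AX f0) measurable_AXtheta.
move=> w _; have h0 := cond_mean_AX_ge0 (AXtheta w) f0.
rewrite /fine_cond_mean_AX; case: (cond_mean_AX f _) h0 => [r|_|//] //=.
by rewrite leey.
Qed.

Lemma integral_fine_cond_mean_AX f (B : set (d.-tuple nat * n.-tuple R)) :
  measurable B -> (forall x, 0 <= f x) ->
  P.-integrable setT (EFin \o (f \o X)) ->
  (\int[P]_(w in (fun w => AXtheta w) @^-1` B)
     (fine_cond_mean_AX f (AXtheta w))%:E =
   \int[P]_(w in (fun w => AXtheta w) @^-1` B) (f (X w))%:E)%E.
Proof.
move=> mB f0 intf; rewrite -integral_cond_mean_AX//.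
have mE : measurable ((fun w => AXtheta w) @^-1` B).
  by rewrite -[X in measurable X]setTI; exact: measurable_AXtheta.
have inth := integrable_cond_mean_AX f0 intf.
apply: ae_eq_integral => //.
- apply: measurable_funTS.
  exact: measurable_int (integrable_fine_cond_mean_AX f0 intf).
- by apply: measurable_funTS; exact: measurable_int inth.
apply: filterS (integrable_ae measurableT inth) => w /(_ I) hfin _.
by rewrite /fine_cond_mean_AX fineK.
Qed.

End cond_mean_X.

(** The event that [Y] equals [Y w] is a preimage under [X], so [Y] is constant on the fibres of
    [X]; the value 0 off the range of [X] is arbitrary. Measurability of the factor is automatic on
    the discrete space where it is applied. *)
Lemma sub_measurable_preimage_factor (dO dN : measure_display)
    (Omega : measurableType dO) (N : measurableType dN) (R : realType)
    (X : Omega -> N) (Y : Omega -> R) :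
  sub_measurable (g_sigma_algebra_preimage X) Y -> exists f, Y = f \o X.
Proof.
move=> mY.
have Yconst w w' : X w = X w' -> Y w = Y w'.
  move=> XX; have [V _ YV] := mY [set Y w] (measurable_set1 _).
  have : (Y @^-1` [set Y w]) w by [].
  rewrite -YV setTI /= XX => Vw'.
  have : (setT `&` X @^-1` V) w' by split.
  by rewrite YV => ->.
exists (fun x => if pselect (exists w, X w = x) is left e
  then Y (projT1 (cid e)) else 0).
apply/funext => w /=; case: pselect => [e|[]]; last by exists w.
by case: cid => w' /= Xw'; apply: Yconst.
Qed.

(** * The generated sigma-algebras and the nuisance property *)

Section nuisance_parameter.
Context (R : realType) (dO : measure_display) (Omega : measurableType dO).
Context (P : probability Omega R) (d n : nat) (A : 'M[int]_(d, n)).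
Context (X : {RV P >-> n.-tuple nat}) (theta : {RV P >-> n.-tuple R}).

Local Notation AXtheta := (fun w => (AX A (X w), theta w)).
Local Notation G :=
  (sigma_join (calO A X theta) (g_sigma_algebra_preimage (Atheta A \o theta))).

Lemma calO_sub_measurable : calO A X theta `<=` measurable.
Proof.
move=> _ [B [mB _ _] <-]; rewrite -[X in measurable X]setTI.
exact: measurable_AXtheta.
Qed.

(** This puts every event of the join in the form to which [integral_fine_cond_mean_AX] applies; the
    events of A theta qualify as preimages through the second coordinate. *)
Lemma sigma_join_sub : G `<=` [set AXtheta @^-1` B | B in measurable].
Proof.
have sub B : measurable B ->
    [set AXtheta @^-1` B | B in measurable] (AXtheta @^-1` B).
  by exists B.
apply: smallest_sub.
  rewrite (_ : [set _ | _ in _] =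
    preimage_set_system setT AXtheta
      (@measurable _ (d.-tuple nat * n.-tuple R)%type)).
    exact/sigma_algebra_preimage/sigma_algebra_measurable.
  by apply/seteqP; split=> _ [B mB <-]; exists B; rewrite ?setTI.
move=> E [[B [mB _ _] <-]|[V mV <-]]; first exact: sub.
rewrite setTI; exists (snd @^-1` (Atheta A @^-1` V)) => //.
rewrite -[X in measurable X]setTI; apply: measurable_snd => //.
by rewrite -[X in measurable X]setTI; exact: measurable_Atheta.
Qed.

End nuisance_parameter.

Theorem corollary1 (R : realType) (dO : measure_display)
    (Omega : measurableType dO) (P : probability Omega R)
    (d n : nat) (A : 'M[int]_(d, n))
    (X : {RV P >-> n.-tuple nat}) (theta : {RV P >-> n.-tuple R})
    (theta_ge0 : forall w : Omega, Theta (theta w))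
    (X_cond : cond_indep_poisson X theta)
    (AX_ge0 : forall (w : Omega) (i : 'I_d), 0 <= mul_nat A (X w) i) :
  nuisance P (g_sigma_algebra_preimage X) (calO A X theta)
    (g_sigma_algebra_preimage (Atheta A \o theta)).
Proof.
have [kappa [rcd kappa_poisson]] := X_cond.
split.
  split; first exact/sigma_algebra_preimage/sigma_algebra_measurable.
  move=> _ [V mV <-]; apply: measurableT_comp => //.
  exact: measurable_Atheta.
split.
  by split; [exact: calO_sigma_algebra|exact: calO_sub_measurable].
move=> Y [mY intY].
have [f Yf] := sub_measurable_preimage_factor mY.
have intfX : P.-integrable setT (EFin \o (f \o X)) by rewrite -Yf.
(* The averaging identities are for nonnegative functions, so [f] is split into positive and
   negative parts, both integrable along [X] as they are bounded by the absolute value of [f]. *)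
pose fp x := Num.max (f x) 0; pose fn x := Num.max (- f x) 0.
have fp0 x : 0 <= fp x by rewrite le_max lexx orbT.
have fn0 x : 0 <= fn x by rewrite le_max lexx orbT.
have fE x : f x = fp x - fn x.
  by rewrite /fp /fn; case: (leP (f x) 0) => ?; case: (leP (- f x) 0) => ?; lra.
have int_le g : (forall x, 0 <= g x) -> (forall x, g x <= `|f x|) ->
    P.-integrable setT (EFin \o (g \o X)).
  move=> g0 gf; apply: le_integrable intfX => //.
    apply/measurable_EFinP; apply: measurableT_comp => // _ U _.
    exact: measurable_tuple_nat.
  by move=> w _; rewrite /= lee_fin ger0_norm.
have intp : P.-integrable setT (EFin \o (fp \o X)).
  by apply: int_le => // x; rewrite /fp ge_max ler_norm normr_ge0.
have intn : P.-integrable setT (EFin \o (fn \o X)).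
  by apply: int_le => // x; rewrite /fn ge_max -normrN ler_norm normr_ge0.
pose h z : R := fine_cond_mean_AX A kappa fp z - fine_cond_mean_AX A kappa fn z.
pose Z w := h (AX A (X w), theta w).
have mh : measurable_fun setT h.
  by apply: measurable_funB; exact: measurable_fine_cond_mean_AX.
have hact g b c : posG g -> Theta c -> h (b, act A g c) = h (b, c).
  move=> g0 c0; rewrite /h /fine_cond_mean_AX /cond_mean_AX /=.
  by congr (fine _ - fine _); apply: cond_mean_act => // x; rewrite lee_fin.
have mZ : sub_measurable (calO A X theta) Z.
  exact: sub_measurable_calO.
exists Z => //; split.
  split; first by move=> U /mZ ?; apply: sub_sigma_algebra; left.
  rewrite (_ : EFin \o Z = (fun w =>
    (fine_cond_mean_AX A kappa fp (AX A (X w), theta w))%:E) \-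
    (fun w => (fine_cond_mean_AX A kappa fn (AX A (X w), theta w))%:E))%E//.
  by apply: integrableB => //; exact: integrable_fine_cond_mean_AX.
move=> E /sigma_join_sub[B mB <-].
have mE : measurable ((fun w => (AX A (X w), theta w)) @^-1` B).
  by rewrite -[X in measurable X]setTI; exact: measurable_AXtheta.
have intS g : P.-integrable setT g ->
    P.-integrable ((fun w => (AX A (X w), theta w)) @^-1` B) g.
  exact: integrableS.
rewrite Yf /Z /h.
under eq_integral do rewrite EFinB.
under [RHS]eq_integral do rewrite /= fE EFinB.
rewrite integralB_EFin//; last 2 first.
- exact/intS/integrable_fine_cond_mean_AX.
- exact/intS/integrable_fine_cond_mean_AX.
rewrite integralB_EFin//; last 2 first.
- exact: intS intp.
- exact: intS intn.
by rewrite !integral_fine_cond_mean_AX.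
Qed.
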